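(* Let $A\in\mathbb M_m$ be a Perron-like matrix with principal eigenvalue $s=s(A)$, let $\delta>0$ be such that $\mathrm{Re}\,\mu\le s-2\delta$ for all $\mu\in\sigma(A)\setminus\{s\}$, let $\nu=\mathrm{Cord}(\mathrm{GE}_s(A))$, and let $d$ be an integer with $\nu-1\le d\le m-1$. Let $V=[v_i]_{i\in J}\in\mathbb M_m$ be nonsingular with $\|V\|=1$, and put $Y=[\Pi_1v_i]_{i\in J}$. Let $\bar s=s+\Delta s\in\mathbb R$, $\bar A=A-\bar sI$, $\bar\lambda=2e^{2\|\bar A\|}$, $$\bar P(t)=\sum_{k=0}^d(-1)^k\frac{t^k}{k!}\bar A^k,\qquad \bar Y(t)=\bar P(t)e^{t\bar A}Y.$$ For $n\in\mathbb N$ let $T_n=\sum_{k=0}^n\frac1{k!}\bar A^k$, define $$\mathcal S_n(0)=V,\qquad \mathcal S_n(k+1)=\frac{T_n\mathcal S_n(k)}{\|T_n\mathcal S_n(k)\|}\quad(k\in\mathbb N),$$ and set $S_n=\mathcal S_n(n)$. Suppose that $|\Delta s|<\delta/9$. Then there is a constant $C>0$ independent of $n$ such that for $n\in\mathbb N$ (with $S_n$ defined, $\bar P(n)S_n\ne0$ and $\bar Y(n)\ne0$), $$\left\|\frac{\bar P(n)S_n}{\|\bar P(n)S_n\|}-\frac{\bar Y(n)}{\|\bar Y(n)\|}\right\|\le C\|\bar P(n)S_n\|^{-1}(1+n^d)\left(\frac{e\bar\lambda\|\bar A\|}{n+1}\right)^{n+1}o(1)+C\|\bar Y(n)\|^{-1}\left(1+n^{d+2(\nu-1)}\right)e^{-\frac29n\delta},$$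 where $o(1)$ is an infinitesimal as $n\to\infty$.
   Context: $J=\{1,\dots,m\}$; $\mathbb N$ is the set of nonnegative integers. $\mathbb M_m$ is the space of real $m\times m$ matrices; $[\alpha_i]_{i\in J}$ denotes the matrix with columns $\alpha_i$. $\mathbb R^m$ carries the Euclidean norm; on $\mathbb M_m$, $\|[\alpha_i]_{i\in J}\|=(\sum_{i\in J}\|\alpha_i\|^2)^{1/2}$. $\sigma(A)$ is the set of (complex) eigenvalues of $A$, $s(A)=\max\{\mathrm{Re}\,\mu:\mu\in\sigma(A)\}$. $A$ is Perron-like if $s:=s(A)\in\sigma(A)$ and $\mathrm{Re}\,\mu<s$ for all $\mu\in\sigma(A)\setminus\{s\}$; $s$ is then called the principal eigenvalue. $\mathrm{GE}_s(A)=\{\xi\in\mathbb R^m:(A-sI)^k\xi=0\text{ for some }k\ge1\}$. For any $\mu\in\sigma(A)$, $\mathrm{GE}_\mu(A)\subset\mathbb R^m$ is the set of all real and imaginary parts of vectors $u\in\mathbb C^m$ with $(A-\mu I)^ku=0$ for some $k\ge1$. Then $\mathbb R^m=E_1\oplus E_2$ with $E_1=\mathrm{GE}_s(A)$, $E_2=\sum_{\mu\in\sigma(A)\setminus\{s\}}\mathrm{GE}_\mu(A)$, and $\Pi_1$ is the projection onto $E_1$ along $E_2$. The cyclic order $\mathrm{Cord}(\mathrm{GE}_s(A))$ is the smallest $\nu\ge1$ with $(A-sI)^\nu\mathrm{GE}_s(A)=\{0\}$. *)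

(* Defs.v *)
From HB Require Import structures.
From mathcomp Require Import all_boot all_order all_algebra.
From mathcomp Require Import all_classical all_reals all_analysis.
From mathcomp Require Import complex.

Set Implicit Arguments.
Unset Strict Implicit.
Unset Printing Implicit Defensive.

Import Order.TTheory GRing.Theory Num.Theory.
Import numFieldNormedType.Exports.

Local Open Scope classical_set_scope.
Local Open Scope ring_scope.

(* MathComp-Analysis puts the sup norm on matrices, so the Euclidean norm of
   vectors and the norm of matrices built from it column by column are defined
   here. *)
Definition vnorm (R : realType) (m : nat) (x : 'cV[R]_m) : R :=
  Num.sqrt (\sum_(i < m) x i 0 ^+ 2).

Definition mnorm (R : realType) (m : nat) (X : 'M[R]_m) : R :=
  Num.sqrt (\sum_(j < m) vnorm (col j X) ^+ 2).

Definition normalized (R : realType) (m : nat) (X : 'M[R]_m) : 'M[R]_m :=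
  (mnorm X)^-1 *: X.

Definition complexify (R : realType) (p q : nat) (X : 'M[R]_(p, q)) :
    'M[R[i]]_(p, q) :=
  map_mx (real_complex R) X.

Definition spectrum (R : realType) (m : nat) (A : 'M[R]_m) : set R[i] :=
  [set mu | eigenvalue (complexify A) mu].

(* The spectrum is finite, and nonempty when 0 < m, so this supremum is then a
   maximum. *)
Definition spectral_bound (R : realType) (m : nat) (A : 'M[R]_m) : R :=
  sup [set complex.Re mu | mu in spectrum A].

Definition Perron_like (R : realType) (m : nat) (A : 'M[R]_m) : Prop :=
  let s := spectral_bound A in
  spectrum A (real_complex R s) /\
  forall mu, spectrum A mu -> mu <> real_complex R s -> complex.Re mu < s.

Definition GE_real (R : realType) (m : nat) (A : 'M[R]_m) (s : R) :
    set 'cV[R]_m :=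
  [set xi | exists2 k : nat, (1 <= k)%N & (A - s%:M) ^+ k *m xi = 0].

Definition GE_complex (R : realType) (m : nat) (A : 'M[R]_m) (mu : R[i]) :
    set 'cV[R[i]]_m :=
  [set u | exists2 k : nat, (1 <= k)%N & (complexify A - mu%:M) ^+ k *m u = 0].

Definition GE_parts (R : realType) (m : nat) (A : 'M[R]_m) (mu : R[i]) :
    set 'cV[R]_m :=
  [set map_mx (@complex.Re R) u | u in GE_complex A mu] `|`
  [set map_mx (@complex.Im R) u | u in GE_complex A mu].

Definition GE_rest (R : realType) (m : nat) (A : 'M[R]_m) (s : R) :
    set 'cV[R]_m :=
  [set \sum_(mu \in spectrum A `\ real_complex R s) f mu
    | f in [set f : R[i] -> 'cV[R]_m |
             forall mu, (spectrum A `\ real_complex R s) mu ->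
               GE_parts A mu (f mu)]].

(* The component in E1 of x, for E1 and E2 in direct sum; the default value 0
   is only used when x is not in E1 + E2. *)
Definition proj_along (R : realType) (m : nat) (E1 E2 : set 'cV[R]_m)
    (x : 'cV[R]_m) : 'cV[R]_m :=
  xget 0 [set y | E1 y /\ E2 (x - y)].

Definition Pi1 (R : realType) (m : nat) (A : 'M[R]_m) : 'cV[R]_m -> 'cV[R]_m :=
  let s := spectral_bound A in proj_along (GE_real A s) (GE_rest A s).

Definition kills_GE (R : realType) (m : nat) (A : 'M[R]_m) (s : R) (k : nat) :
    Prop :=
  [set (A - s%:M) ^+ k *m xi | xi in GE_real A s] = [set 0].

Definition is_Cord (R : realType) (m : nat) (A : 'M[R]_m) (s : R) (nu : nat) :
    Prop :=
  [/\ (1 <= nu)%N, kills_GE A s nu &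
      forall k : nat, (1 <= k)%N -> kills_GE A s k -> (nu <= k)%N].

Definition exp_partial (R : realType) (m : nat) (B : 'M[R]_m) (n : nat) :
    'M[R]_m :=
  \sum_(0 <= k < n.+1) (k`!%:R)^-1 *: B ^+ k.

Definition expmx (R : realType) (m : nat) (B : 'M[R]_m) : 'M[R]_m :=
  limn (exp_partial B).

Definition Pbar (R : realType) (m : nat) (B : 'M[R]_m) (d : nat) (t : R) :
    'M[R]_m :=
  \sum_(0 <= k < d.+1) ((-1) ^+ k * (t ^+ k / k`!%:R)) *: B ^+ k.

Definition Ybar (R : realType) (m : nat) (B Y : 'M[R]_m) (d : nat) (t : R) :
    'M[R]_m :=
  Pbar B d t *m expmx (t *: B) *m Y.

Definition Siter (R : realType) (m : nat) (B V : 'M[R]_m) (n k : nat) :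
    'M[R]_m :=
  iter k (fun S => normalized (exp_partial B n *m S)) V.

(* No normalization performed in computing Siter B V n n divides by zero. *)
Definition Siter_defined (R : realType) (m : nat) (B V : 'M[R]_m) (n : nat) :
    Prop :=
  forall k : nat, (k < n)%N -> exp_partial B n *m Siter B V n k <> 0.

(* Main.v *)
Require Import Defs.
From HB Require Import structures.
From mathcomp Require Import all_boot all_order all_algebra.
From mathcomp Require Import all_classical all_reals all_analysis.
From mathcomp Require Import complex.
From mathcomp Require Import ring lra.

(* Write B for Abar.  The difference is split through the intermediate matrix
   P(n) e^(nB) V.  The numerical part compares T_n^n with (e^B)^n: the Taylor
   remainder is at most |B|^(n+1) e^|B| / (n+1)!, it is amplified by at most
   n e^(n|B|), and |T_n^n V| >= e^(-n|B|) / 2 for large n, so the relative error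
   is of order n (e e^(2|B|) |B| / (n+1))^(n+1).  The factor 2 in lambdabar leaves
   n / 2^(n+1) -> 0, which is the announced infinitesimal.  The spectral part is
   e^(nB) (V - Y): its columns are sums of real and imaginary parts of generalized
   eigenvectors u for eigenvalues mu of real part at most s - 2 delta, and e^(nB) u
   is e^(n (mu - sbar)) times a polynomial in n.  Exponentials are handled
   through partial sums: for commuting x and y, the norm of
   texp n x * texp n y - texp n (x + y) is bounded by the same expression in
   the norms of x and y, which tends to 0 by the scalar addition formula. *)

Import Order.TTheory GRing.Theory Num.Theory.
Import numFieldNormedType.Exports.

Local Open Scope classical_set_scope.
Local Open Scope ring_scope.

Set Implicit Arguments.
Unset Strict Implicit.
Unset Printing Implicit Defensive.

(** * Partial sums of the exponential series *)

Section exp_sum.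
Variables (F : numFieldType) (T : algType F).
Implicit Types x y : T.

(** Stated over any algebra so that real and complex scalars, seen as [R^o] and [R[i]^o], and square
    matrices share one addition formula. *)
Definition texp n x : T := \sum_(0 <= k < n.+1) (k`!%:R)^-1 *: x ^+ k.

Let term x y i j : T := (i`!%:R * j`!%:R)^-1 *: (x ^+ i * y ^+ j).

(** The defect of the addition formula: the terms of total degree above [n] in the product of two
    partial sums. *)
Definition texp_tail n x y : T :=
  \sum_(0 <= i < n.+1) \sum_(0 <= j < n.+1 | (n < i + j)%N) term x y i j.

(** The binomial theorem turns each [(x + y) ^+ k / k!] into the antidiagonal [i + j = k]; these
    antidiagonals fill the triangle [i + j <= n]. *)
Lemma texpDE n x y : GRing.comm x y -> texp n (x + y) =
  \sum_(0 <= i < n.+1) \sum_(0 <= j < n.+1 | (i + j <= n)%N) term x y i j.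
Proof.
move=> cxy.
transitivity (\sum_(0 <= k < n.+1) \sum_(0 <= j < n.+1 | (j <= k)%N)
    term x y (k - j) j).
  apply: eq_big_nat => k /andP[_ kn].
  rewrite exprDn_comm // scaler_sumr.
  rewrite -(big_mkord xpredT
    (fun j => (k`!%:R)^-1 *: (x ^+ (k - j) * y ^+ j *+ 'C(k, j)))).
  rewrite (big_nat_widen _ _ _ _ _ kn).
  apply: eq_bigr => j; rewrite ltnS => jk.
  rewrite -[_ *+ 'C(k, j)]scaler_nat scalerA; congr (_ *: _).
  rewrite -(bin_fact jk) !natrM !invfM.
  have h a : a`!%:R != 0 :> F by rewrite pnatr_eq0 -lt0n fact_gt0.
  have hb : 'C(k, j)%:R != 0 :> F by rewrite pnatr_eq0 -lt0n bin_gt0.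
  by field; rewrite !h hb.
(* With [j] outermost on both sides, the shift [k = i + j] identifies the inner sums. *)
rewrite (exchange_big_dep_nat xpredT) //=.
rewrite [RHS](exchange_big_dep_nat xpredT) //=.
apply: eq_big_nat => j /andP[_ jn].
rewrite -(big_nat_widenl j 0 n.+1 xpredT) // -{1}(add0n j) big_addn.
rewrite (big_nat_widen _ _ n.+1) ?leq_subr //=.
apply: eq_big => [i|i _]; first by rewrite ltn_subRL addnC ltnS.
by rewrite addnK.
Qed.

Lemma texpM n x y : GRing.comm x y ->
  texp n x * texp n y = texp n (x + y) + texp_tail n x y.
Proof.
move=> cxy; rewrite texpDE // -big_split mulr_suml.
apply: eq_bigr => i _; rewrite mulr_sumr.
rewrite (bigID (fun j => i + j <= n)%N) /=; congr (_ + _); last first.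
  rewrite (eq_bigl (fun j => (n < i + j)%N)); last by move=> j; rewrite ltnNge.
  by apply: eq_bigr => j _; rewrite -scalerAl -scalerAr scalerA /term invfM.
by apply: eq_bigr => j _; rewrite -scalerAl -scalerAr scalerA /term invfM.
Qed.

End exp_sum.

Section exp_sum_bound.
Variables (R : realType) (F : numFieldType) (T : algType F) (N : T -> R).
Hypothesis N0 : N 0 = 0.
Hypothesis ND : forall x y, N (x + y) <= N x + N y.
Hypothesis NZ : forall n x, N (n%:R^-1 *: x) = n%:R^-1 * N x.

Lemma seminorm_sum (I : Type) (r : seq I) (P : pred I) (f : I -> T) :
  N (\sum_(i <- r | P i) f i) <= \sum_(i <- r | P i) N (f i).
Proof.
elim/big_ind2 : _ => [|a b c e h1 h2|//]; first by rewrite N0.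
by apply: le_trans (ND _ _) _; apply: lerD.
Qed.

(** The seminorm is real while the scalars may be complex, so homogeneity is asked only for the
    scalars [1 / n]. The factor [c] allows seminorms such as the norm of [Z *m X], and norms in
    which the identity does not have norm 1. *)
Lemma texp_bound n x (a c : R) : (forall i, N (x ^+ i) <= a ^+ i * c) ->
  N (texp n x) <= texp n (a : R^o) * c.
Proof.
move=> h; apply: le_trans (seminorm_sum _ _ _) _; rewrite mulr_suml.
apply: ler_sum => i _; rewrite NZ -[_ *: _]/(_ * _) -mulrA.
by rewrite ler_pM2l // invr_gt0 ltr0n fact_gt0.
Qed.

Lemma texp_tail_bound n x y (a b c : R) :
  (forall i j, N (x ^+ i * y ^+ j) <= a ^+ i * b ^+ j * c) ->
  N (texp_tail n x y) <= texp_tail n (a : R^o) (b : R^o) * c.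
Proof.
move=> h; apply: le_trans (seminorm_sum _ _ _) _; rewrite mulr_suml.
apply: ler_sum => i _; apply: le_trans (seminorm_sum _ _ _) _.
rewrite mulr_suml; apply: ler_sum => j _.
rewrite -natrM NZ -natrM -[_ *: _]/(_ * _) -mulrA.
by rewrite ler_pM2l // invr_gt0 ltr0n muln_gt0 !fact_gt0 .
Qed.

End exp_sum_bound.

Section real_exp_sum.
Variable R : realType.
Implicit Types a b : R^o.

Lemma texp_series n a : texp n a = series (exp_coeff a) n.+1.
Proof.
rewrite /texp /series /=; apply: eq_bigr => i _.
by rewrite -[_ *: _]/(_ * _) mulrC.
Qed.

Lemma texp_cvg a : texp n a @[n --> \oo] --> expR (a : R).
Proof.
under eq_fun do rewrite texp_series.
have h : series (exp_coeff (a : R)) @ \oo --> expR (a : R).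
  exact: is_cvg_series_exp_coeff.
by move: h; rewrite -cvg_shiftS.
Qed.

(** The tail is the difference between a product of partial sums and the partial sum at [a + b];
    both tend to [expR (a + b)]. Matrix and complex tails are dominated by this scalar one. *)
Lemma texp_tail_cvg0 a b : texp_tail n a b @[n --> \oo] --> (0 : R).
Proof.
have -> : (fun n => texp_tail n a b) =
    (fun n => texp n a * texp n b - texp n (a + b)).
  apply/funext => n; have /(texpM n) -> : GRing.comm a b by rewrite /GRing.comm mulrC.
  by rewrite addrC addKr.
rewrite -(subrr (expR ((a : R) + (b : R)))) {1}expRD.
by apply: cvgB; [apply: cvgM|]; exact: texp_cvg.
Qed.

Lemma texp_le_expR n a : 0 <= a -> texp n a <= expR (a : R).
Proof.
move=> a0; rewrite -(cvg_lim (@Rhausdorff R) (@texp_cvg a)).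
apply: (@nondecreasing_cvgn_le R (fun n => texp n a)); last first.
  by apply/cvg_ex; exists (expR (a : R)); exact: texp_cvg.
apply/nondecreasing_seqP => k; rewrite /texp [leRHS]big_nat_recr //= lerDl.
by rewrite -[_ *: _]/(_ * _) mulr_ge0 ?invr_ge0 // exprn_ge0.
Qed.

End real_exp_sum.

(** * The Euclidean norm and the matrix exponential *)

Section euclidean_norm.
Variable R : realType.

(** Lagrange's identity: twice the gap between the two sides is the sum of the squares of
    [a i * b j - a j * b i]. *)
Lemma Cauchy_Schwarz_sum (I : finType) (a b : I -> R) :
  (\sum_i a i * b i) ^+ 2 <= (\sum_i a i ^+ 2) * (\sum_i b i ^+ 2).
Proof.
have h : \sum_i \sum_j (a i * b j - a j * b i) ^+ 2 =
    2 * ((\sum_i a i ^+ 2) * (\sum_i b i ^+ 2) - (\sum_i a i * b i) ^+ 2).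
  have e1 : (\sum_i a i ^+ 2) * (\sum_i b i ^+ 2) =
      \sum_i \sum_j a i ^+ 2 * b j ^+ 2.
    by rewrite mulr_suml; apply: eq_bigr => i _; rewrite mulr_sumr.
  have e2 : (\sum_i a i * b i) ^+ 2 =
      \sum_i \sum_j (a i * b i) * (a j * b j).
    by rewrite expr2 mulr_suml; apply: eq_bigr => i _; rewrite mulr_sumr.
  have e3 : \sum_i \sum_j a i ^+ 2 * b j ^+ 2 = \sum_i \sum_j a j ^+ 2 * b i ^+ 2.
    by rewrite exchange_big.
  rewrite mulr_natl mulrnBl mulr2n e1 {2}e3 e2.
  rewrite -sumrMnl -big_split -sumrB /=.
  apply: eq_bigr => i _; rewrite -sumrMnl -big_split -sumrB /=.
  by apply: eq_bigr => j _; ring.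
rewrite -subr_ge0 -(pmulr_rge0 _ (ltr0Sn R 1)) -h.
by apply: sumr_ge0 => i _; apply: sumr_ge0 => j _; apply: sqr_ge0.
Qed.

Lemma Minkowski_sum (I : finType) (a b : I -> R) :
  Num.sqrt (\sum_i (a i + b i) ^+ 2) <=
  Num.sqrt (\sum_i a i ^+ 2) + Num.sqrt (\sum_i b i ^+ 2).
Proof.
have sq0 (f : I -> R) : 0 <= \sum_i f i ^+ 2.
  by apply: sumr_ge0 => i _; apply: sqr_ge0.
rewrite -ler_sqr ?nnegrE ?addr_ge0 ?sqrtr_ge0 //.
rewrite sqrrD !sqr_sqrtr //.
have -> : \sum_i (a i + b i) ^+ 2 =
    \sum_i a i ^+ 2 + (\sum_i a i * b i) *+ 2 + \sum_i b i ^+ 2.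
  rewrite -sumrMnl -!big_split /=.
  by apply: eq_bigr => i _; rewrite sqrrD.
rewrite lerD2r lerD2l lerMn2r /= -sqrtrM //.
apply: le_trans (ler_norm _) _; rewrite -sqrtr_sqr.
exact/ler_wsqrtr/Cauchy_Schwarz_sum.
Qed.

Variable m : nat.
Implicit Types X Y : 'M[R]_m.

Lemma mnormE X : mnorm X = Num.sqrt (\sum_i \sum_j X i j ^+ 2).
Proof.
rewrite /mnorm exchange_big /=; congr Num.sqrt; apply: eq_bigr => j _.
rewrite /vnorm sqr_sqrtr; last by apply: sumr_ge0 => i _; apply: sqr_ge0.
by apply: eq_bigr => i _; rewrite mxE.
Qed.

Lemma mnorm_ge0 X : 0 <= mnorm X.
Proof. exact: sqrtr_ge0. Qed.

Lemma sqr_mnorm X : mnorm X ^+ 2 = \sum_i \sum_j X i j ^+ 2.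
Proof.
rewrite mnormE sqr_sqrtr //.
by apply: sumr_ge0 => i _; apply: sumr_ge0 => j _; apply: sqr_ge0.
Qed.

Lemma mnormD X Y : mnorm (X + Y) <= mnorm X + mnorm Y.
Proof.
have h (Z : 'M[R]_m) : mnorm Z = Num.sqrt (\sum_p Z p.1 p.2 ^+ 2).
  by rewrite mnormE pair_bigA.
rewrite !h; apply: le_trans (Minkowski_sum _ _).
by under eq_bigr do rewrite mxE.
Qed.

Lemma mnormM X Y : mnorm (X *m Y) <= mnorm X * mnorm Y.
Proof.
rewrite -ler_sqr ?nnegrE ?mulr_ge0 ?mnorm_ge0 // exprMn !sqr_mnorm.
rewrite mulr_suml; apply: ler_sum => i _.
rewrite (exchange_big _ _ _ _ _ (fun i j => Y i j ^+ 2)) /= mulr_sumr.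
by apply: ler_sum => j _; rewrite mxE; apply: Cauchy_Schwarz_sum.
Qed.

Lemma mnormZ (c : R) X : mnorm (c *: X) = `|c| * mnorm X.
Proof.
rewrite !mnormE -sqrtr_sqr -sqrtrM ?sqr_ge0 // mulr_sumr; congr Num.sqrt.
apply: eq_bigr => i _; rewrite mulr_sumr; apply: eq_bigr => j _.
by rewrite mxE exprMn.
Qed.

Lemma mnorm0 : mnorm (0 : 'M[R]_m) = 0.
Proof. by rewrite -(scale0r 0) mnormZ normr0 mul0r. Qed.

Lemma mnormN X : mnorm (- X) = mnorm X.
Proof. by rewrite -scaleN1r mnormZ normrN1 mul1r. Qed.

Lemma ler_mnormB X Y : mnorm X - mnorm Y <= mnorm (X - Y).
Proof. by rewrite lerBlDr; apply: le_trans (mnormD _ _); rewrite subrK. Qed.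

Lemma ler_entry_mnorm X i j : `|X i j| <= mnorm X.
Proof.
rewrite -ler_sqr ?nnegrE ?mnorm_ge0 // sqr_mnorm real_normK ?num_real //.
rewrite (bigD1 i) //= (bigD1 j) //= -addrA lerDl addr_ge0 //.
  by apply: sumr_ge0 => k _; apply: sqr_ge0.
by apply: sumr_ge0 => k _; apply: sumr_ge0 => l _; apply: sqr_ge0.
Qed.

Lemma mnorm_eq0 X : mnorm X = 0 -> X = 0.
Proof.
move=> X0; apply/matrixP => i j; rewrite mxE; apply/eqP.
by rewrite -normr_le0 -X0 ler_entry_mnorm.
Qed.

Lemma mnorm_gt0 X : X <> 0 -> 0 < mnorm X.
Proof.
move=> X0; rewrite lt_neqAle mnorm_ge0 andbT eq_sym.
by apply/eqP => /mnorm_eq0.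
Qed.

Lemma mnorm_le_sum X : mnorm X <= \sum_i \sum_j `|X i j|.
Proof.
have s0 : 0 <= \sum_i \sum_j `|X i j|.
  by apply: sumr_ge0 => i _; apply: sumr_ge0.
rewrite -ler_sqr ?nnegrE ?mnorm_ge0 // sqr_mnorm [leRHS]expr2 mulr_suml.
apply: ler_sum => i _; rewrite mulr_suml; apply: ler_sum => j _.
rewrite -[X i j ^+ 2]real_normK ?num_real // expr2 ler_wpM2l //.
rewrite (bigD1 i) //= (bigD1 j) //= -addrA lerDl addr_ge0 //.
  exact: sumr_ge0.
by apply: sumr_ge0 => k _; apply: sumr_ge0.
Qed.

(** Limits are handled entry by entry, so that the sup-norm topology on matrices never has to be
    compared with [mnorm]. *)
Lemma mnorm_cvg (u : nat -> 'M[R]_m) (L : 'M[R]_m) :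
  (forall i j, u n i j @[n --> \oo] --> L i j) ->
  mnorm (u n) @[n --> \oo] --> mnorm L.
Proof.
move=> uL; under eq_fun do rewrite mnormE.
rewrite mnormE; apply: (@continuous_cvg _ _ _ _ _ _ (@Num.sqrt R)).
  exact: sqrt_continuous.
apply: cvg_big => [|i _]; first exact: add_continuous.
apply: cvg_big => [|j _]; first exact: add_continuous.
by rewrite expr2; under eq_fun do rewrite expr2; apply: cvgM.
Qed.

(* With [Z = 0] the normalization is [0], and the bound still holds since
   [X / |X|] has norm at most [1]. *)
Lemma normalizedB X Z : X <> 0 ->
  mnorm (normalized X - normalized Z) <= 2 * (mnorm X)^-1 * mnorm (X - Z).
Proof.
move=> /mnorm_gt0 X0; have Xi : 0 < (mnorm X)^-1 by rewrite invr_gt0.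
have -> : normalized X - normalized Z =
    (mnorm X)^-1 *: (X - Z) + ((mnorm X)^-1 - (mnorm Z)^-1) *: Z.
  by rewrite /normalized scalerBr scalerBl addrA subrK.
apply: le_trans (mnormD _ _) _; rewrite !mnormZ (gtr0_norm Xi).
rewrite -mulrA mulr_natl mulr2n lerD2l.
have [Z0|Z0] := eqVneq (mnorm Z) 0.
  by rewrite Z0 mulr0 mulr_ge0 ?mnorm_ge0 // ltW.
have -> : (mnorm X)^-1 - (mnorm Z)^-1 =
    (mnorm X)^-1 * (mnorm Z - mnorm X) / mnorm Z.
  by field; rewrite Z0 gt_eqF.
rewrite !normrM !normfV !(ger0_norm (mnorm_ge0 _)) mulfVK //.
rewrite ler_pM2l // ler_norml; apply/andP; split; last first.
  by rewrite -(mnormN (X - Z)) opprB ler_mnormB.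
by rewrite -(opprB (mnorm X)) lerN2 ler_mnormB.
Qed.

End euclidean_norm.

Section matrix_exponential.
Variables (R : realType) (m : nat).
Implicit Types (B X : 'M[R]_m.+1) (n : nat).

Lemma exp_partialE B n : exp_partial B n = texp n B.
Proof. by []. Qed.

Lemma matrix_cvg (u : nat -> 'M[R]_m.+1) (L : 'M[R]_m.+1) :
  (forall i j, u n i j @[n --> \oo] --> L i j) -> u n @[n --> \oo] --> L.
Proof.
move=> uL; apply/cvg_ballP => e e0.
have h : \forall n \near \oo, forall i j, ball (L i j) e (u n i j).
  apply: filter_forall => i; apply: filter_forall => j.
  by have /cvg_ballP := uL i j; exact.
by apply: filterS h => n h; split.
Qed.

Lemma mnorm_exprM B X k : mnorm (B ^+ k *m X) <= mnorm B ^+ k * mnorm X.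
Proof.
elim: k => [|k IH]; first by rewrite !expr0 mul1mx mul1r.
rewrite !exprS -[B * _]/(B *m _) -mulmxA -mulrA.
by apply: le_trans (mnormM _ _) _; rewrite ler_wpM2l ?mnorm_ge0.
Qed.

(** Each entry of the series is dominated by the scalar exponential series of [mnorm B], hence
    converges absolutely. *)
Lemma expmx_cvg_entry B i j :
  exp_partial B n i j @[n --> \oo] --> expmx B i j.
Proof.
(* Any entrywise limit is a limit of matrices, hence is the [limn] that defines [expmx]. *)
suff [L uL] : exists L : 'M[R]_m.+1, forall i j,
    exp_partial B n i j @[n --> \oo] --> L i j.
  by rewrite /expmx (cvg_lim _ (matrix_cvg uL)) //; exact: norm_hausdorff.
pose c i j k := (k`!%:R)^-1 * (B ^+ k) i j.
have cv p q : cvgn (series (c p q)).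
  apply: normed_cvg.
  apply: (@series_le_cvg _ _ (fun k => exp_coeff (mnorm B) k * mnorm (1 : 'M[R]_m.+1))).
  - by move=> k; exact: normr_ge0.
  - by move=> k; rewrite mulr_ge0 ?mnorm_ge0 ?exp_coeff_ge0 ?mnorm_ge0.
  - move=> k; rewrite /= /c normrM normfV (ger0_norm (ler0n _ _)) exp_coeffE -mulrA.
    rewrite ler_pM2l ?invr_gt0 ?ltr0n ?fact_gt0 //.
    apply: le_trans (mnorm_exprM _ _ _).
    by rewrite mulmx1; exact: ler_entry_mnorm.
  - have -> : series (fun k => exp_coeff (mnorm B) k * mnorm (1 : 'M[R]_m.+1)) =
      (fun n => series (exp_coeff (mnorm B)) n * mnorm (1 : 'M[R]_m.+1)).
      by apply/funext => n; rewrite /series /= mulr_suml.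
    apply: is_cvgM; first exact: is_cvg_series_exp_coeff.
    exact: is_cvg_cst.
exists (\matrix_(p, q) limn (series (c p q))) => p q; rewrite mxE.
have -> : (fun n => exp_partial B n p q) = (fun n => series (c p q) n.+1).
  apply/funext => n; rewrite /exp_partial summxE /series /=.
  by apply: eq_bigr => k _; rewrite mxE.
have := cv p q; rewrite -(cvg_shiftS _ _); exact.
Qed.

Lemma expmxM_cvg_entry B X i j :
  (exp_partial B n *m X) i j @[n --> \oo] --> (expmx B *m X) i j.
Proof.
under eq_fun do rewrite mxE.
rewrite mxE; apply: cvg_big => [|k _]; first exact: add_continuous.
by apply: cvgM; [exact: expmx_cvg_entry|exact: cvg_cst].
Qed.

Lemma mnorm_exp_partial B X n :
  mnorm (exp_partial B n *m X) <= expR (mnorm B) * mnorm X.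
Proof.
rewrite exp_partialE.
apply: le_trans (_ : texp n (mnorm B : R^o) * mnorm X <= _); last first.
  by rewrite ler_wpM2r ?mnorm_ge0 // texp_le_expR ?mnorm_ge0.
apply: (texp_bound (N := fun Z : 'M[R]_m.+1 => mnorm (Z *m X))).
- by rewrite mul0mx mnorm0.
- by move=> Y Z; rewrite mulmxDl mnormD.
- by move=> k Z; rewrite -scalemxAl mnormZ ger0_norm ?invr_ge0.
- by move=> k; exact: mnorm_exprM.
Qed.

Lemma mnorm_expmx B X : mnorm (expmx B *m X) <= expR (mnorm B) * mnorm X.
Proof.
have cv : mnorm (exp_partial B n *m X) @[n --> \oo] --> mnorm (expmx B *m X).
  by apply: mnorm_cvg => i j; exact: expmxM_cvg_entry.
have cst : (fun=> expR (mnorm B) * mnorm X) @ \oo --> expR (mnorm B) * mnorm X.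
  exact: cvg_cst.
apply: (ler_cvg_to cv cst); near=> n; exact: mnorm_exp_partial.
Unshelve. all: by end_near. Qed.

(** The defect at rank [n] is [texp_tail n B C], whose norm is at most the vanishing scalar tail at
    the norms of [B] and [C], times the norm of the identity. *)
Lemma expmxD B C : GRing.comm B C -> expmx (B + C) = expmx B *m expmx C.
Proof.
move=> cBC; apply/eqP; rewrite eq_sym -subr_eq0; apply/eqP/mnorm_eq0.
apply/eqP; rewrite eq_le mnorm_ge0 andbT.
have cv : mnorm (texp n B *m texp n C - texp n (B + C)) @[n --> \oo] -->
    mnorm (expmx B *m expmx C - expmx (B + C)).
  apply: mnorm_cvg => i j.
  under eq_fun do rewrite !mxE.
  rewrite !mxE; apply: cvgB; last exact: expmx_cvg_entry.
  apply: cvg_big => [|k _]; first exact: add_continuous.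
  by apply: cvgM; exact: expmx_cvg_entry.
have cv0 : texp_tail n (mnorm B : R^o) (mnorm C : R^o) * mnorm (1 : 'M[R]_m.+1)
    @[n --> \oo] --> (0 : R).
  rewrite -(mul0r (mnorm (1 : 'M[R]_m.+1))).
  by apply: cvgM; [exact: texp_tail_cvg0|exact: cvg_cst].
apply: (ler_cvg_to cv cv0); near=> n.
rewrite -[texp n B *m _]/(texp n B * _) texpM // addrAC subrr add0r.
apply: (texp_tail_bound (N := @mnorm R m.+1)).
- exact: mnorm0.
- exact: mnormD.
- by move=> k Z; rewrite mnormZ ger0_norm ?invr_ge0.
- move=> i j; rewrite -[B ^+ i * _]/(B ^+ i *m _) -mulrA.
  apply: le_trans (mnorm_exprM _ _ _) _.
  rewrite ler_wpM2l ?exprn_ge0 ?mnorm_ge0 //.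
  by rewrite -[C ^+ j]mulmx1; exact: mnorm_exprM.
Unshelve. all: by end_near. Qed.

Lemma expmx0 : expmx (0 : 'M[R]_m.+1) = 1.
Proof.
apply/matrixP => i j; apply: (cvg_unique (@Rhausdorff R) (@expmx_cvg_entry 0 i j)).
have -> : (fun n => exp_partial (0 : 'M[R]_m.+1) n i j) = fun=> (1 : 'M[R]_m.+1) i j.
  apply/funext => n; rewrite /exp_partial big_nat_recl // big1 => [|k _].
    by rewrite expr0 invr1 scale1r addr0.
  by rewrite exprS mul0r scaler0.
exact: cvg_cst.
Qed.

Lemma expmx_natZ B n : expmx (n%:R *: B) = expmx B ^+ n.
Proof.
elim: n => [|n IH]; first by rewrite scale0r expr0 expmx0.
rewrite exprSr -IH -natr1 scalerDl scale1r expmxD //.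
by rewrite /GRing.comm -scalerAl -scalerAr.
Qed.

(** Apply the upper bound for [expmx (- B)] to [X = expmx (- B) *m (expmx B *m X)]. *)
Lemma mnorm_expmx_ge B X : expR (- mnorm B) * mnorm X <= mnorm (expmx B *m X).
Proof.
rewrite expRN mulrC ler_pdivrMr ?expR_gt0 //.
have {1}-> : X = expmx (- B) *m (expmx B *m X).
  by rewrite mulmxA -expmxD ?addNr ?expmx0 ?mul1mx //; exact/commr_sym/commrN.
by rewrite mulrC -(mnormN B); exact: mnorm_expmx.
Qed.

End matrix_exponential.

(** * Generalized eigenvectors *)

Section generalized_eigenvectors.
Variables (K : closedFieldType) (m : nat) (g : 'M[K]_m.+1).

(** Primary decomposition: the characteristic polynomial splits into pairwise coprime powers of
    ['X - z], and the kernel of their product, the whole space by Cayley-Hamilton, is the sum of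
    their kernels. *)
Lemma generalized_eigen_decomposition (u : 'cV[K]_m.+1) :
  exists (r : seq K) (f : K -> 'cV[K]_m.+1),
  [/\ uniq r, (forall z, (z \in r) = eigenvalue g z),
      (forall z, z \in r ->
         exists2 k, (1 <= k)%N & (g - z%:M) ^+ k *m f z = 0) &
      u = \sum_(z <- r) f z].
Proof.
(* [kermxpoly] consists of row vectors, so the argument runs on the transpose and is transposed
   back. *)
pose h := g^T.
have char_tr : char_poly h = char_poly g.
  rewrite /char_poly -[RHS]det_tr /char_poly_mx linearB /= tr_scalar_mx.
  by rewrite map_trmx.
have [rs prs] := closed_field_poly_normal (char_poly h).
move: prs; rewrite (monicP (char_poly_monic h)) scale1r => prs.
pose r := undup rs; pose c z := count_mem z rs.
have c0 z : z \in r -> (0 < c z)%N.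
  by rewrite mem_undup /c -has_count has_pred1.
have r_ev z : (z \in r) = eigenvalue g z.
  by rewrite mem_undup eigenvalue_root_char -char_tr prs root_prod_XsubC.
pose q (i : 'I_(size r)) := ('X - (r`_i)%:P) ^+ c r`_i.
have prodq : char_poly h = \prod_i q i.
  rewrite prs -prodr_undup_exp_count (big_nth 0) big_mkord.
  by apply: eq_bigr.
have cop : {in predT &, forall i j, j != i -> coprimep (q i) (q j)}.
  move=> i j _ _ ji; apply/coprimep_expl/coprimep_expr.
  by rewrite coprimep_XsubC root_XsubC nth_uniq ?undup_uniq // eq_sym.
have full : (kermxpoly h (\prod_i q i) :=: 1)%MS.
  by apply: kermxpoly_min; rewrite -prodq mxminpoly_dvd_char.
have /sub_sumsmxP[w uw] : (u^T <= \sum_i kermxpoly h (q i))%MS.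
  by rewrite -(kermxpoly_prod h cop) full submx1.
pose v i := (w i *m kermxpoly h (q i))^T.
(* As [r] has no repetition, the sum has exactly one term for [z] in [r]; this form makes the
   component a function of the eigenvalue rather than of its index. *)
exists r, (fun z => \sum_(i < size r | r`_i == z) v i); split.
- exact: undup_uniq.
- exact: r_ev.
- move=> z zr; exists (c z); first exact: c0.
  rewrite mulmx_sumr big1 // => i /eqP riz.
  apply: trmx_inj; rewrite trmx0 trmx_mul trmxK -mulmxA.
  suff -> : ((g - z%:M) ^+ c z)^T = horner_mx h (q i) by rewrite mulmx_ker mulmx0.
  rewrite rmorphXn rmorphB /= horner_mx_X horner_mx_C riz.
  elim: (c z) => [|k IH]; first by rewrite !expr0 trmx1.
  by rewrite exprS exprSr -IH -[_ * _]/(_ *m _) trmx_mul linearB /= tr_scalar_mx.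
- apply: trmx_inj; rewrite uw [in RHS](big_nth 0) big_mkord linear_sum /=.
  apply: eq_bigr => j _.
  rewrite (big_pred1 j) ?trmxK // => i /=.
  by rewrite nth_uniq ?undup_uniq.
Qed.

End generalized_eigenvectors.

(** * Real and imaginary parts, and the decomposition of real vectors *)

Section real_parts.
Variable R : realType.

Lemma ReD (x y : R[i]) : complex.Re (x + y) = complex.Re x + complex.Re y.
Proof. by case: x; case: y. Qed.

Lemma ImD (x y : R[i]) : complex.Im (x + y) = complex.Im x + complex.Im y.
Proof. by case: x; case: y. Qed.

Lemma ReZ (a : R) (z : R[i]) : complex.Re (real_complex R a * z) = a * complex.Re z.
Proof. by case: z => x y /=; rewrite mul0r subr0. Qed.

Lemma ImZ (a : R) (z : R[i]) : complex.Im (real_complex R a * z) = a * complex.Im z.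
Proof. by case: z => x y /=; rewrite mul0r addr0. Qed.

Lemma map_Re_mul m n p (M : 'M[R]_(m, n)) (u : 'M[R[i]]_(n, p)) :
  map_mx (@complex.Re R) (complexify M *m u) = M *m map_mx (@complex.Re R) u.
Proof.
apply/matrixP => i j; rewrite !mxE (big_morph _ ReD (erefl : complex.Re 0 = 0)).
by apply: eq_bigr => k _; rewrite !mxE ReZ.
Qed.

Lemma map_Im_mul m n p (M : 'M[R]_(m, n)) (u : 'M[R[i]]_(n, p)) :
  map_mx (@complex.Im R) (complexify M *m u) = M *m map_mx (@complex.Im R) u.
Proof.
apply/matrixP => i j; rewrite !mxE (big_morph _ ImD (erefl : complex.Im 0 = 0)).
by apply: eq_bigr => k _; rewrite !mxE ImZ.
Qed.

(** Decompose the complexified vector and take real parts: the [s]-component gives [y], the others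
    give an element of [GE_rest]. *)
Lemma GE_decomposition m (A : 'M[R]_m.+1) (s : R) (x : 'cV[R]_m.+1) :
  exists2 y, GE_real A s y & GE_rest A s (x - y).
Proof.
have [r [f [ur rev rge xf]]] :=
  generalized_eigen_decomposition (complexify A) (complexify x).
pose S := real_complex R s; pose re := map_mx (@complex.Re R) : 'cV__ -> 'cV_m.+1.
have re_sum (t : seq R[i]) : re (\sum_(z <- t) f z) = \sum_(z <- t) re (f z).
  apply/matrixP => i j; rewrite mxE !summxE (big_morph _ ReD (erefl : complex.Re 0 = 0)).
  by apply: eq_bigr => z _; rewrite mxE.
have xre : x = \sum_(z <- r) re (f z).
  by rewrite -re_sum -xf; apply/matrixP => i j; rewrite !mxE.
exists (\sum_(z <- r | z == S) re (f z)).
  (* The filtered list is [[:: S]] or empty; in the second case [s] is not an eigenvalue and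
     [y = 0]. *)
  rewrite -big_filter (perm_big (if S \in r then [:: S] else [::])); last first.
    apply: uniq_perm; rewrite ?filter_uniq //; first by case: ifP.
    move=> z; rewrite mem_filter; case: ifP => Sr; rewrite !inE.
      by case: eqVneq => // ->.
    by case: eqVneq => // ->.
  case: ifP => [/rge[k k1 fk]|_]; last first.
    by exists 1%N => //; rewrite big_nil mulmx0.
  exists k => //; rewrite big_seq1 -map_Re_mul.
  have -> : complexify ((A - s%:M) ^+ k) = (complexify A - S%:M) ^+ k.
    by rewrite /complexify rmorphXn /= map_mxB map_scalar_mx.
  by rewrite fk; apply/matrixP => i j; rewrite !mxE.
exists (re \o f).
  move=> mu [muA _]; left; exists (f mu) => //.
  by apply: rge; rewrite rev.
have -> : x - \sum_(z <- r | z == S) re (f z) = \sum_(z <- r | z != S) re (f z).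
  by rewrite [in LHS]xre (bigID (fun z => z == S)) /= addrAC subrr add0r.
rewrite -[in RHS]big_filter [RHS]fsbig_seq ?filter_uniq //.
suff -> : [set` [seq z <- r | z != S]] = spectrum A `\ S by [].
apply/seteqP; split => mu /=; rewrite mem_filter rev.
  by move=> /andP[/eqP muS].
by move=> [muA /eqP ->].
Qed.

End real_parts.

(** * Decay of the exponential on generalized eigenvectors *)

Section complex_norm.
Variable R : realType.
Notation normc := (@ComplexField.Normc.normc R).

Lemma normc_ge0 (z : R[i]) : 0 <= normc z.
Proof. by case: z => a b; exact: sqrtr_ge0. Qed.

Lemma normcD (x y : R[i]) : normc (x + y) <= normc x + normc y.
Proof. exact: le_normcD. Qed.

Lemma normcM (x y : R[i]) : normc (x * y) = normc x * normc y.
Proof. exact: ComplexField.Normc.normcM. Qed.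

Lemma normcX (z : R[i]) k : normc (z ^+ k) = normc z ^+ k.
Proof.
elim: k => [|k IH]; first by rewrite !expr0 ComplexField.Normc.normc1.
by rewrite !exprS normcM IH.
Qed.

Lemma normc_real (a : R) : normc (real_complex R a) = `|a|.
Proof. by rewrite /= expr0n addr0 sqrtr_sqr. Qed.

Lemma normc_invn n : normc (n%:R^-1) = n%:R^-1.
Proof.
rewrite -(rmorph_nat (real_complex R)) -fmorphV normc_real.
by rewrite ger0_norm.
Qed.

Lemma normc_conj (z : R[i]) : normc (conjc z) = normc z.
Proof. by case: z => a b; rewrite /= sqrrN. Qed.

Lemma ler_normRe_normc (z : R[i]) : `|complex.Re z| <= normc z.
Proof.
case: z => a b /=; rewrite -sqrtr_sqr ler_wsqrtr // lerDl; exact: sqr_ge0.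
Qed.

Lemma ler_normIm_normc (z : R[i]) : `|complex.Im z| <= normc z.
Proof.
case: z => a b /=; rewrite -sqrtr_sqr ler_wsqrtr // lerDr; exact: sqr_ge0.
Qed.

(** A real-valued norm on complex matrices, submultiplicative for all rectangular sizes, so that it
    serves matrices and columns alike. *)
Definition l1norm m n (X : 'M[R[i]]_(m, n)) : R := \sum_i \sum_j normc (X i j).

Lemma l1norm_ge0 m n (X : 'M[R[i]]_(m, n)) : 0 <= l1norm X.
Proof. by apply: sumr_ge0 => i _; apply: sumr_ge0 => j _; exact: normc_ge0. Qed.

Lemma l1norm0 m n : l1norm (0 : 'M[R[i]]_(m, n)) = 0.
Proof.
rewrite /l1norm big1 // => i _; rewrite big1 // => j _.
by rewrite mxE ComplexField.Normc.normc0.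
Qed.

Lemma l1normD m n (X Y : 'M[R[i]]_(m, n)) : l1norm (X + Y) <= l1norm X + l1norm Y.
Proof.
rewrite /l1norm -big_split; apply: ler_sum => i _.
by rewrite -big_split; apply: ler_sum => j _; rewrite mxE normcD.
Qed.

Lemma l1normZ m n z (X : 'M[R[i]]_(m, n)) : l1norm (z *: X) = normc z * l1norm X.
Proof.
rewrite /l1norm mulr_sumr; apply: eq_bigr => i _.
by rewrite mulr_sumr; apply: eq_bigr => j _; rewrite mxE normcM.
Qed.

Lemma l1norm_sum m n I (r : seq I) (P : pred I) (X : I -> 'M[R[i]]_(m, n)) :
  l1norm (\sum_(i <- r | P i) X i) <= \sum_(i <- r | P i) l1norm (X i).
Proof.
elim/big_ind2 : _ => [|a b c e h1 h2|//]; first by rewrite l1norm0.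
by apply: le_trans (l1normD _ _) _; apply: lerD.
Qed.

Lemma ler_entry_l1norm m n (X : 'M[R[i]]_(m, n)) i j : normc (X i j) <= l1norm X.
Proof.
rewrite /l1norm (bigD1 i) //= (bigD1 j) //= -addrA lerDl addr_ge0 //.
  by apply: sumr_ge0 => k _; exact: normc_ge0.
by apply: sumr_ge0 => k _; apply: sumr_ge0 => l _; exact: normc_ge0.
Qed.

Lemma l1normM m n p (X : 'M[R[i]]_(m, n)) (Y : 'M[R[i]]_(n, p)) :
  l1norm (X *m Y) <= l1norm X * l1norm Y.
Proof.
rewrite [leRHS]mulr_suml; apply: ler_sum => i _.
apply: le_trans (_ : \sum_k \sum_j normc (X i j) * normc (Y j k) <= _).
  apply: ler_sum => k _; rewrite mxE.
  elim/big_ind2 : _ => [|a b c e h1 h2|j _]; first by rewrite ComplexField.Normc.normc0.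
    by apply: le_trans (normcD _ _) _; apply: lerD.
  by rewrite normcM.
rewrite exchange_big mulr_suml; apply: ler_sum => j _ /=.
rewrite -mulr_sumr ler_wpM2l ?normc_ge0 //.
rewrite /l1norm (bigD1 j) //= lerDl.
by apply: sumr_ge0 => k _; apply: sumr_ge0 => l _; exact: normc_ge0.
Qed.

(* [texp n z] times its conjugate is [texp n (2 Re z)] up to a vanishing tail, so
   complex exponentials are bounded without introducing their limit. *)
Lemma normc_texp n (z : R[i]) :
  normc (texp n (z : R[i]^o)) <=
  Num.sqrt (`|texp n (2 * complex.Re z : R^o)| +
            texp_tail n (normc z : R^o) (normc z : R^o)).
Proof.
set t := texp n _.
have -> : normc t = Num.sqrt (normc (t * conjc t)).
  by rewrite normcM normc_conj -expr2 sqrtr_sqr ger0_norm // normc_ge0.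
apply: ler_wsqrtr.
have -> : conjc t = texp n (conjc z : R[i]^o).
  rewrite /t /texp rmorph_sum; apply: eq_bigr => k _.
  by rewrite -[_ *: _]/(_ * _) rmorphM /= rmorphXn /= fmorphV rmorph_nat.
have /(texpM n) -> : GRing.comm (z : R[i]^o) (conjc z).
  by rewrite /GRing.comm mulrC.
apply: le_trans (normcD _ _) _; apply: lerD.
  have -> : z + conjc z = real_complex R (2 * complex.Re z).
    by case: z @t => a b; apply/eqP; rewrite eq_complex /= mulr_natl mulr2n subrr !eqxx.
  rewrite -normc_real; suff <- : real_complex R (texp n (2 * complex.Re z : R^o)) =
    texp n (real_complex R (2 * complex.Re z) : R[i]^o) by [].
  rewrite /texp rmorph_sum; apply: eq_bigr => k _.
  rewrite -[_ *: _]/(_ * _) -[in RHS]/(_ * _).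
  by rewrite rmorphM /= rmorphXn /= fmorphV rmorph_nat.
rewrite -[leRHS]mulr1.
apply: (texp_tail_bound (T := R[i]^o) (N := normc)).
- exact: ComplexField.Normc.normc0.
- exact: normcD.
- by move=> k x; rewrite -[_ *: _]/(_ * _) normcM normc_invn.
- by move=> i j; rewrite mulr1 normcM !normcX normc_conj.
Qed.

End complex_norm.

Lemma expr_div_fact_le_expR (R : realType) (a : R) k :
  0 <= a -> a ^+ k / k`!%:R <= expR a.
Proof.
move=> a0; apply: le_trans (texp_le_expR k (a0 : 0 <= (a : R^o))).
rewrite /texp big_nat_recr //= -[_ *: _ in leRHS]/(_ * _) [_^-1 * _]mulrC lerDr.
by apply: sumr_ge0 => i _; rewrite mulr_ge0 ?invr_ge0 // exprn_ge0.
Qed.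

Section generalized_eigenvector_decay.
Variables (R : realType) (m : nat).
Notation normc := (@ComplexField.Normc.normc R).

Lemma complexify_texp (B : 'M[R]_m.+1) n :
  complexify (texp n B) = texp n (complexify B).
Proof.
rewrite /complexify /texp raddf_sum; apply: eq_bigr => k _ /=.
by rewrite map_mxZ /= rmorphXn /= fmorphV rmorph_nat.
Qed.

Lemma texp_scalar_mx n (w : R[i]) :
  texp n (w%:M : 'M[R[i]]_m.+1) = (texp n (w : R[i]^o) : R[i])%:M.
Proof.
rewrite /texp raddf_sum; apply: eq_bigr => k _ /=.
by rewrite -[_ *: _ in RHS]/(_ * _) -rmorphXn /= scale_scalar_mx.
Qed.

(** All terms of degree at least [k] kill [u], which leaves a bound independent of [n]. *)
Lemma l1norm_texp_nilpotent n k (D : 'M[R[i]]_m.+1) (u : 'cV[R[i]]_m.+1) :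
  D ^+ k *m u = 0 -> (k <= n)%N ->
  l1norm (texp n D *m u) <= \sum_(0 <= j < k) (j`!%:R)^-1 * l1norm (D ^+ j *m u).
Proof.
move=> Dk kn; rewrite /texp mulmx_suml (big_cat_nat (n := k)) //=; last exact: leqW.
rewrite [X in _ + X]big_nat_cond [X in _ + X]big1 ?addr0 => [|j /andP[/andP[kj _] _]].
  apply: le_trans (l1norm_sum _ _ _) _; apply: ler_sum => j _.
  by rewrite -scalemxAl l1normZ normc_invn.
by rewrite -(subnK kj) exprD -scalemxAl -[_ * _]/(_ *m _) -mulmxA Dk mulmx0 scaler0.
Qed.

(** Write [complexify B = w + D]: the scalar part contributes [exp (Re w)] and the series of [D] at
    [u] stops at degree [k]. The domination hypothesis lets [x] be either the real or the imaginary
    part of [u]. *)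
Lemma expmx_generalized_eigenvector (B : 'M[R]_m.+1) (w : R[i]) k
    (u : 'cV[R[i]]_m.+1) (x : 'cV[R]_m.+1) :
  (complexify B - w%:M) ^+ k *m u = 0 ->
  (forall (M : 'M[R]_m.+1) i,
     `|(M *m x) i 0| <= normc ((complexify M *m u) i 0)) ->
  forall i, `|(expmx B *m x) i 0| <= expR (complex.Re w) *
    \sum_(0 <= j < k) (j`!%:R)^-1 * l1norm ((complexify B - w%:M) ^+ j *m u).
Proof.
set D := complexify B - w%:M; move=> Dk xu i.
set K := \sum_(0 <= j < k) _.
have K0 : 0 <= K.
  by apply: sumr_ge0 => j _; rewrite mulr_ge0 ?invr_ge0 ?l1norm_ge0.
(* [a n] bounds the modulus of the scalar partial sum at [w] and tends to [exp (Re w)]; [b n] bounds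
   the addition defect applied to [u] and tends to 0. *)
pose a n := Num.sqrt (`|texp n (2 * complex.Re w : R^o)| +
            texp_tail n (normc w : R^o) (normc w : R^o)).
pose b n := texp_tail n (normc w : R^o) (l1norm D : R^o) *
            (l1norm (1 : 'M[R[i]]_m.+1) * l1norm u).
have cvB : `|(texp n B *m x) i 0| @[n --> \oo] --> `|(expmx B *m x) i 0|.
  apply: cvg_norm; under eq_fun do rewrite mxE.
  rewrite mxE; apply: cvg_big => [|j _]; first exact: add_continuous.
  by apply: cvgM; [exact: expmx_cvg_entry|exact: cvg_cst].
have cva : a n @[n --> \oo] --> expR (complex.Re w).
  have -> : expR (complex.Re w) =
      Num.sqrt (`|expR (2 * complex.Re w)| + 0).
    rewrite addr0 ger0_norm ?expR_ge0 // mulr_natl mulr2n expRD -expr2.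
    by rewrite sqrtr_sqr ger0_norm // expR_ge0.
  apply: (@continuous_cvg _ _ _ _ _ _ (@Num.sqrt R)); first exact: sqrt_continuous.
  apply: cvgD; last exact: texp_tail_cvg0.
  by apply: cvg_norm; exact: texp_cvg.
have cvb : b n @[n --> \oo] --> (0 : R).
  rewrite -(mul0r (l1norm (1 : 'M[R[i]]_m.+1) * l1norm u)).
  by apply: cvgM; [exact: texp_tail_cvg0|exact: cvg_cst].
have cvK : a n * K + b n @[n --> \oo] --> expR (complex.Re w) * K.
  rewrite -[X in _ --> X]addr0; apply: cvgD => //.
  by apply: cvgM => //; exact: cvg_cst.
apply: (ler_cvg_to cvB cvK); near=> n.
apply: le_trans (xu _ _) _; apply: le_trans (ler_entry_l1norm _ _ _) _.
have BE : complexify B = w%:M + D by rewrite addrC subrK.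
have cwD : GRing.comm (w%:M : 'M[R[i]]_m.+1) D by exact/commr_sym/scalar_mxC.
rewrite complexify_texp BE.
have -> : texp n (w%:M + D) = texp n w%:M *m texp n D - texp_tail n w%:M D.
  by rewrite -[_ *m _]/(_ * _) (texpM n cwD) addrK.
rewrite mulmxBl; apply: le_trans (l1normD _ _) _; apply: lerD.
  rewrite texp_scalar_mx mul_scalar_mx -scalemxAl l1normZ.
  apply: ler_pM; rewrite ?normc_ge0 ?l1norm_ge0 ?normc_texp //.
  by apply: l1norm_texp_nilpotent => //; near: n; exact: nbhs_infty_ge.
rewrite -scaleN1r l1normZ -(rmorphN1 (real_complex R)) normc_real normrN1 mul1r.
apply: (texp_tail_bound (N := fun Z : 'M[R[i]]_m.+1 => l1norm (Z *m u))).
- by rewrite mul0mx l1norm0.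
- by move=> Y Z; rewrite mulmxDl l1normD.
- by move=> p Z; rewrite -scalemxAl l1normZ normc_invn.
- have nX p : l1norm (D ^+ p *m u) <=
      l1norm D ^+ p * (l1norm (1 : 'M[R[i]]_m.+1) * l1norm u).
    elim: p => [|p IH]; first by rewrite !expr0 mul1r; exact: l1normM.
    rewrite !exprS -[D * _]/(D *m _) -mulmxA -mulrA.
    by apply: le_trans (l1normM _ _) _; rewrite ler_wpM2l ?l1norm_ge0.
  move=> p q; rewrite -rmorphXn /= -[_ * _]/(_ *m _) mul_scalar_mx -scalemxAl.
  by rewrite l1normZ normcX -mulrA ler_wpM2l ?exprn_ge0 ?normc_ge0.
Unshelve. all: by end_near. Qed.

End generalized_eigenvector_decay.

Section decay.
Variables (R : realType) (m : nat).
Implicit Types (A B : 'M[R]_m.+1) (x y : 'cV[R]_m.+1).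
Notation normc := (@ComplexField.Normc.normc R).

(** The constant is uniform in [n] and in the entry but depends on [x]; the property is stable under
    sums, which carries it from [GE_parts] to [GE_rest]. *)
Definition exp_decay B (r : R) x :=
  exists K, forall n i, `|(expmx (n%:R *: B) *m x) i 0| <= K * expR (- (r * n%:R)).

Lemma exp_decay0 B r : exp_decay B r 0.
Proof. by exists 0 => n i; rewrite mulmx0 mxE normr0 mul0r. Qed.

Lemma exp_decayD B r x y : exp_decay B r x -> exp_decay B r y -> exp_decay B r (x + y).
Proof.
move=> [K hK] [L hL]; exists (K + L) => n i.
by rewrite mulmxDr mxE mulrDl; apply: le_trans (ler_normD _ _) (lerD _ _).
Qed.

(** The factors [n ^ j] produced by the nilpotent part are absorbed by lowering the rate from [r']
    to [r]. *)
Lemma generalized_eigenvector_decay A (sbar r r' : R) (mu : R[i]) k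
    (u : 'cV[R[i]]_m.+1) x :
  (complexify A - mu%:M) ^+ k *m u = 0 ->
  (forall (M : 'M[R]_m.+1) i,
     `|(M *m x) i 0| <= normc ((complexify M *m u) i 0)) ->
  complex.Re mu - sbar <= - r' -> r < r' -> exp_decay (A - sbar%:M) r x.
Proof.
set D := complexify A - mu%:M => Dk xu mur rr'.
pose eta := r' - r; have eta0 : 0 < eta by rewrite subr_gt0.
pose c j := l1norm (D ^+ j *m u).
(* The constant comes from [(eta * n) ^ j / j! <= exp (eta * n)] with [eta = r' - r]. *)
exists (\sum_(0 <= j < k) c j / eta ^+ j) => n i.
have CD : complexify (n%:R *: (A - sbar%:M)) - (n%:R * (mu - real_complex R sbar))%:M =
    n%:R *: D.
  rewrite /complexify map_mxZ /= map_mxB map_scalar_mx /= rmorph_nat.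
  by rewrite -scale_scalar_mx -scalerBr rmorphB /= /D opprB addrA subrK.
apply: le_trans (@expmx_generalized_eigenvector _ _ (n%:R *: (A - sbar%:M))
  (n%:R * (mu - real_complex R sbar)) k u x _ xu i) _.
  by rewrite CD exprZn -scalemxAl Dk scaler0.
rewrite CD.
have -> : complex.Re (n%:R * (mu - real_complex R sbar)) =
    n%:R * (complex.Re mu - sbar).
  by rewrite -(rmorph_nat (real_complex R)) ReZ; case: (mu).
rewrite mulrC !mulr_suml; apply: ler_sum => j _.
have -> : l1norm ((n%:R *: D) ^+ j *m u) = n%:R ^+ j * c j.
  rewrite exprZn -scalemxAl l1normZ; congr (_ * _).
  by rewrite -natrX -(rmorph_nat (real_complex R)) normc_real ger0_norm // natrX.
have cj0 : 0 <= c j by exact: l1norm_ge0.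
have etaj : 0 < eta ^+ j by rewrite exprn_gt0.
have e1 : (eta * n%:R) ^+ j / j`!%:R <= expR (eta * n%:R).
  by apply: expr_div_fact_le_expR; rewrite mulr_ge0 // ltW.
have e2 : expR (n%:R * (complex.Re mu - sbar)) <= expR (- (r' * n%:R)).
  by rewrite ler_expR mulrC -mulNr ler_wpM2r.
have -> : - (r * n%:R) = eta * n%:R + - (r' * n%:R) by rewrite /eta; ring.
rewrite expRD.
have -> : j`!%:R^-1 * (n%:R ^+ j * c j) =
    c j / eta ^+ j * ((eta * n%:R) ^+ j / j`!%:R).
  have f0 : j`!%:R != 0 :> R by rewrite pnatr_eq0 -lt0n fact_gt0.
  by rewrite exprMn; field; rewrite ?f0 ?gt_eqF.
rewrite -[leLHS]mulrA ler_wpM2l ?divr_ge0 ?(ltW etaj) //.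
by apply: ler_pM; rewrite ?expR_ge0 // divr_ge0 // exprn_ge0 // mulr_ge0 // ltW.
Qed.

Lemma GE_parts_decay A (sbar r r' : R) (mu : R[i]) x :
  complex.Re mu - sbar <= - r' -> r < r' ->
  GE_parts A mu x -> exp_decay (A - sbar%:M) r x.
Proof.
move=> mur rr' [] [u [k _ uk] <-];
  apply: (generalized_eigenvector_decay uk _ mur rr') => M i.
- by rewrite -map_Re_mul mxE ler_normRe_normc.
- by rewrite -map_Im_mul mxE ler_normIm_normc.
Qed.

Lemma GE_rest_decay A (s sbar r r' : R) x :
  (forall mu, spectrum A mu -> mu <> real_complex R s ->
     complex.Re mu - sbar <= - r') -> r < r' ->
  GE_rest A s x -> exp_decay (A - sbar%:M) r x.
Proof.
move=> mur rr' [f fGE <-].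
(* A sum with infinite support is 0 by convention. *)
case: finite_supportP => [_|X XE _ _]; first by rewrite big_nil; exact: exp_decay0.
rewrite big_seq.
elim/big_ind : _ => [|y z|mu muX]; [exact: exp_decay0|exact: exp_decayD|].
have [muA mus] := XE _ muX.
by apply: (GE_parts_decay (mur _ muA mus) rr'); exact: fGE.
Qed.

(** Each column of [V - Y] lies in [GE_rest], since it is a column of [V] minus its projection. *)
Lemma sub_Pi1_decay A (s := spectral_bound A) (sbar r r' : R) (V : 'M[R]_m.+1) :
  (forall mu, spectrum A mu -> mu <> real_complex R s ->
     complex.Re mu - sbar <= - r') -> r < r' ->
  exists2 K, 0 <= K & forall n,
  mnorm (expmx (n%:R *: (A - sbar%:M)) *m
    (V - \matrix_(i, j) Pi1 A (col j V) i 0)) <= K * expR (- (r * n%:R)).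
Proof.
move=> mur rr'; set Y := \matrix_(i, j) _.
have colY j : exp_decay (A - sbar%:M) r (col j (V - Y)).
  apply: (GE_rest_decay mur rr').
  have -> : col j (V - Y) = col j V - Pi1 A (col j V).
    by apply/matrixP => i k; rewrite !mxE ord1.
  have [y y1 y2] := GE_decomposition A s (col j V).
  rewrite /Pi1 /proj_along.
  (* The decomposition just obtained shows that [xget] does not return its default value. *)
  by case: xgetP => [z -> []//|/(_ y)]; case.
have /choice[K hK] : forall j, exists K, forall n i,
  `|(expmx (n%:R *: (A - sbar%:M)) *m col j (V - Y)) i 0| <=
    K * expR (- (r * n%:R)) by [].
exists (\sum_(i < m.+1) \sum_j `|K j|).
  by apply: sumr_ge0 => i _; apply: sumr_ge0.
move=> n; apply: le_trans (mnorm_le_sum _) _.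
rewrite mulr_suml; apply: ler_sum => i _; rewrite mulr_suml; apply: ler_sum => j _.
have -> : (expmx (n%:R *: (A - sbar%:M)) *m (V - Y)) i j =
   (expmx (n%:R *: (A - sbar%:M)) *m col j (V - Y)) i 0.
  by rewrite !mxE; apply: eq_bigr => l _; rewrite !mxE.
apply: le_trans (hK j n i) _.
by rewrite ler_wpM2r ?expR_ge0 // ler_norm.
Qed.

End decay.

(** * Powers of the Taylor polynomial *)

Section taylor_error.
Variables (R : realType) (m : nat) (B : 'M[R]_m.+1).
Implicit Types X V : 'M[R]_m.+1.
Let b := mnorm B.

Definition taylor_error n : R := b ^+ n.+1 / (n.+1)`!%:R * expR b.

Lemma taylor_error_ge0 n : 0 <= taylor_error n.
Proof. by rewrite mulr_ge0 ?expR_ge0 // divr_ge0 // exprn_ge0 // mnorm_ge0. Qed.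

(** Factor out the first term of the tail, using [(k + n + 1)! >= k! * (n + 1)!], which holds
    because the binomial coefficient is at least 1. *)
Lemma expR_tail_bound n N :
  \sum_(n.+1 <= k < N) (k`!%:R)^-1 * b ^+ k <= taylor_error n.
Proof.
have b0 : 0 <= b by exact: mnorm_ge0.
rewrite -{1}[n.+1]add0n big_addn.
apply: le_trans (_ : b ^+ n.+1 / (n.+1)`!%:R *
    \sum_(0 <= k < N - n.+1) (k`!%:R)^-1 * b ^+ k <= _).
  rewrite mulr_sumr; apply: ler_sum => k _.
  rewrite exprD [leRHS](_ : _ = (n.+1`!%:R * k`!%:R)^-1 * (b ^+ k * b ^+ n.+1)).
    rewrite ler_wpM2r ?mulr_ge0 ?exprn_ge0 //.
    rewrite lef_pV2 ?posrE -?natrM ?ltr0n ?muln_gt0 ?fact_gt0 //.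
    rewrite ler_nat -(@bin_fact (k + n.+1) n.+1) ?leq_addl // addnK.
    by rewrite leq_pmull // bin_gt0 leq_addl.
  by rewrite invfM; ring.
rewrite ler_wpM2l ?divr_ge0 ?exprn_ge0 //.
case: (N - n.+1)%N => [|p]; first by rewrite big_nil expR_ge0.
exact: (@texp_le_expR R p b).
Qed.

Lemma mnorm_expmxB_partial n X :
  mnorm ((expmx B - exp_partial B n) *m X) <= taylor_error n * mnorm X.
Proof.
have cv : mnorm (exp_partial B N *m X - exp_partial B n *m X) @[N --> \oo] -->
    mnorm ((expmx B - exp_partial B n) *m X).
  rewrite mulmxBl; apply: mnorm_cvg => i j.
  under eq_fun do rewrite mxE [X in _ + X]mxE.
  rewrite mxE [X in _ + X]mxE.
  by apply: cvgB; [exact: expmxM_cvg_entry|exact: cvg_cst].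
have cst : (fun=> taylor_error n * mnorm X) @ \oo --> taylor_error n * mnorm X.
  exact: cvg_cst.
apply: (ler_cvg_to cv cst); near=> N.
have nN : (n <= N)%N by near: N; exact: nbhs_infty_ge.
rewrite -mulmxBl /exp_partial (big_cat_nat (n := n.+1) (p := N.+1)) //=.
rewrite addrAC subrr add0r mulmx_suml.
apply: le_trans (seminorm_sum (N := @mnorm R m.+1) _ _ _ _ _) _.
- exact: mnorm0.
- exact: mnormD.
apply: le_trans (_ : (\sum_(n.+1 <= k < N.+1) (k`!%:R)^-1 * b ^+ k) * mnorm X <= _).
  rewrite mulr_suml; apply: ler_sum => k _.
  rewrite -scalemxAl mnormZ ger0_norm ?invr_ge0 // -mulrA.
  by rewrite ler_wpM2l ?invr_ge0 // mnorm_exprM.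
by rewrite ler_wpM2r ?mnorm_ge0 // expR_tail_bound.
Unshelve. all: by end_near. Qed.

(** Induction on [k], splitting [T ^ (k + 1) - M ^ (k + 1)] as [T (T ^ k - M ^ k) - (M - T) M ^ k];
    both [T] and [M] enlarge norms by at most [expR b]. *)
Lemma mnorm_exprB_partial n k X :
  mnorm ((exp_partial B n ^+ k - expmx B ^+ k) *m X) <=
  k%:R * taylor_error n * expR b ^+ k * mnorm X.
Proof.
set T := exp_partial B n; set M := expmx B.
have powM j : mnorm (M ^+ j *m X) <= expR b ^+ j * mnorm X.
  elim: j => [|j IH]; first by rewrite !expr0 mul1mx mul1r.
  rewrite !exprS -[M * _]/(M *m _) -mulmxA -mulrA.
  by apply: le_trans (mnorm_expmx _ _) _; rewrite ler_wpM2l ?expR_ge0.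
elim: k => [|k IH]; first by rewrite !expr0 subrr mul0mx mnorm0 !mul0r.
have -> : T ^+ k.+1 - M ^+ k.+1 = T *m (T ^+ k - M ^+ k) - (M - T) *m M ^+ k.
  by rewrite mulmxBr mulmxBl !exprS opprB addrA subrK.
rewrite mulmxBl -!mulmxA; apply: le_trans (mnormD _ _) _; rewrite mnormN.
have h1 : mnorm (T *m ((T ^+ k - M ^+ k) *m X)) <=
    expR b * (k%:R * taylor_error n * expR b ^+ k * mnorm X).
  apply: le_trans (mnorm_exp_partial _ _ _) _.
  by rewrite ler_wpM2l ?expR_ge0.
have h2 : mnorm ((M - T) *m (M ^+ k *m X)) <=
    taylor_error n * (expR b ^+ k.+1 * mnorm X).
  apply: le_trans (mnorm_expmxB_partial _ _) _.
  rewrite ler_wpM2l ?taylor_error_ge0 //; apply: le_trans (powM k) _.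
  (* The exponent is raised from [k] to [k + 1] so that both summands carry the same power. *)
  rewrite ler_wpM2r ?mnorm_ge0 // exprS ler_peMl ?exprn_ge0 ?expR_ge0 //.
  by apply: le_trans (expR_ge1Dx _); rewrite lerDl mnorm_ge0.
apply: le_trans (lerD h1 h2) _; rewrite -natr1 exprS le_eqVlt; apply/orP; left.
by apply/eqP; ring.
Qed.

Lemma mnorm_expmxX_ge k X : expR (- b) ^+ k * mnorm X <= mnorm (expmx B ^+ k *m X).
Proof.
elim: k => [|k IH]; first by rewrite !expr0 mul1mx mul1r.
rewrite !exprS -[expmx B * _]/(expmx B *m _) -mulmxA -mulrA.
apply: le_trans (mnorm_expmx_ge _ _).
by rewrite ler_wpM2l ?expR_ge0.
Qed.

Lemma mnorm_Pbar d n X :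
  mnorm (Pbar B d n%:R *m X) <= expR b * (1 + n%:R ^+ d) * mnorm X.
Proof.
rewrite /Pbar mulmx_suml.
apply: le_trans (seminorm_sum (N := @mnorm R m.+1) _ _ _ _ _) _.
- exact: mnorm0.
- exact: mnormD.
apply: le_trans (_ : texp d (b : R^o) * (1 + n%:R ^+ d) * mnorm X <= _); last first.
  rewrite ler_wpM2r ?mnorm_ge0 // ler_wpM2r ?addr_ge0 ?exprn_ge0 //.
  by apply: texp_le_expR; exact: mnorm_ge0.
rewrite !mulr_suml !big_nat; apply: ler_sum => k /andP[_ kd].
rewrite -scalemxAl mnormZ -[_ *: _ in leRHS]/(_ * _).
rewrite !normrM normrX normrN1 expr1n mul1r normfV !ger0_norm ?exprn_ge0 //.
(* The summand 1 covers [n = 0] and [k = 0], where [n ^ k] is 1 while [n ^ d] may be 0. *)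
have nkd : n%:R ^+ k <= 1 + n%:R ^+ d :> R.
  case: n => [|n].
    rewrite expr0n; case: k {kd} => [|k] /=; first by rewrite lerDl exprn_ge0.
    by rewrite addr_ge0 ?exprn_ge0.
  by rewrite -[leLHS]add0r lerD // ler_weXn2l // ler1n.
rewrite [_ / _]mulrC -!mulrA ler_wpM2l ?invr_ge0 //.
rewrite [leRHS]mulrCA ler_pM ?exprn_ge0 ?mnorm_ge0 //.
exact: mnorm_exprM.
Qed.

Lemma normalizedZ (c : R) X : 0 < c -> normalized (c *: X) = normalized X.
Proof.
move=> c0; rewrite /normalized mnormZ (gtr0_norm c0) scalerA invfM.
by rewrite mulrAC mulVf ?gt_eqF // mul1r.
Qed.

(** Normalizations only rescale by positive factors, so they collapse into a single one at the end.
    A vanishing [T ^ (k + 1) V] would make a normalization undefined. *)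
Lemma Siter_power n V k : mnorm V = 1 ->
  (forall j, (j < k)%N -> exp_partial B n *m Siter B V n j <> 0) ->
  Siter B V n k = normalized (exp_partial B n ^+ k *m V) /\
  0 < mnorm (exp_partial B n ^+ k *m V).
Proof.
set T := exp_partial B n => V1.
elim: k => [|k IH] Tk.
  by rewrite expr0 mul1mx /normalized V1 invr1 scale1r ltr01.
have [j jk|Sk Tk0] := IH; first by apply: Tk; exact: ltnW.
have TS : T *m Siter B V n k = (mnorm (T ^+ k *m V))^-1 *: (T ^+ k.+1 *m V).
  by rewrite Sk /normalized -scalemxAr mulmxA exprS.
split.
  rewrite /Siter iterS -/(Siter B V n k) -/T TS normalizedZ // invr_gt0 //.
apply: mnorm_gt0 => TkV; apply: (Tk k) => //.
by rewrite TS TkV scaler0.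
Qed.

End taylor_error.

(** * Elementary asymptotics *)

Section asymptotics.
Variable R : realType.

(** Gives [n / 2 ^ (n + 1) <= 2 / (n + 1)], a comparison with the harmonic sequence. *)
Lemma mulnS_le_expn n : (n * n.+1 <= 2 ^ n.+2)%N.
Proof.
elim: n => [|n IH] //.
have -> : (n.+1 * n.+2 = n * n.+1 + 2 * n.+1)%N by rewrite -mulnDl addn2 mulnC.
rewrite [leqRHS]expnS [leqRHS]mul2n -[leqRHS]addnn leq_add // expnS leq_mul2l /=.
exact: ltnW (ltn_expl _ _).
Qed.

Lemma natr_div_expr2_bound n : n%:R / 2 ^+ n.+1 <= 2 * (n.+1)%:R^-1 :> R.
Proof.
rewrite ler_pdivrMr ?exprn_gt0 // mulrAC ler_pdivlMr ?ltr0n //.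
by rewrite -exprS -natrX -natrM ler_nat mulnS_le_expn.
Qed.

Lemma natr_div_expr2_cvg0 : n%:R / 2 ^+ n.+1 @[n --> \oo] --> (0 : R).
Proof.
apply: (@squeeze_cvgr _ _ _ _ (fun=> 0) (fun n => 2 * (n.+1)%:R^-1)).
- by near=> n; rewrite divr_ge0 ?exprn_ge0 //= natr_div_expr2_bound.
- exact: cvg_cst.
- by rewrite -[X in _ --> X](mulr0 2); apply: cvgMr; exact: cvg_harmonic.
Unshelve. all: by end_near. Qed.

(** A weak form of Stirling: [n ^ n / n! <= e ^ n], a single term of the series of [exp n]. *)
Lemma expr_div_fact_bound (b : R) n : 0 <= b ->
  b ^+ n / n`!%:R <= (expR 1 * b / n%:R) ^+ n.
Proof.
case: n => [|n] b0; first by rewrite !expr0 invr1 mulr1.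
have n0 : 0 < n.+1%:R :> R by rewrite ltr0n.
have f0 : 0 < n.+1`!%:R :> R by rewrite ltr0n fact_gt0.
have := @expr_div_fact_le_expR R n.+1%:R n.+1 (ltW n0).
rewrite -[in expR _](mulr1 n.+1%:R) expRM_natl => h.
rewrite 2!exprMn [expR 1 ^+ _ * _]mulrC -mulrA ler_wpM2l ?exprn_ge0 //.
rewrite exprVn ler_pdivlMr ?exprn_gt0 // mulrC //.
Qed.

End asymptotics.

(** * The numerical error relative to the announced rate *)

Section normalized_power_error.
Variables (R : realType) (m : nat) (B V : 'M[R]_m.+1) (d : nat).
Hypothesis V1 : mnorm V = 1.
Let b := mnorm B.
Let rate n := (expR 1 * (2 * expR (2 * b)) * b / n.+1%:R) ^+ n.+1.
Let err n :=
  mnorm (Pbar B d n%:R *m ((exp_partial B n ^+ n - expmx B ^+ n) *m V)).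
Let size_T n := mnorm (exp_partial B n ^+ n *m V).

(** The infinitesimal of the theorem, taken as the exact quotient of the numerical error by its
    announced size; the factor 2 comes from [normalizedB]. The quotient is 0 by convention when
    [rate n] vanishes. *)
Definition power_error_ratio n : R :=
  2 * (err n / size_T n) / ((1 + n%:R ^+ d) * rate n).

Let b0 : 0 <= b. Proof. exact: mnorm_ge0. Qed.

Let rate_ge0 n : 0 <= rate n.
Proof.
by rewrite exprn_ge0 // divr_ge0 // mulr_ge0 // ?mulr_ge0 ?expR_ge0 // ltW ?expR_gt0.
Qed.

Let pd_gt0 n : 0 < 1 + n%:R ^+ d :> R.
Proof. by rewrite ltr_pwDl ?ltr01 ?exprn_ge0. Qed.

Let err_le n : err n <=
  expR b * (1 + n%:R ^+ d) * (n%:R * taylor_error B n * expR b ^+ n).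
Proof.
apply: le_trans (mnorm_Pbar _ _ _ _) _.
rewrite ler_wpM2l ?mulr_ge0 ?expR_ge0 ?(ltW (pd_gt0 _)) //.
by apply: le_trans (mnorm_exprB_partial _ _ _ _) _; rewrite V1 mulr1.
Qed.

Lemma power_error_ratio_ge0 n : 0 <= power_error_ratio n.
Proof.
by rewrite divr_ge0 ?mulr_ge0 ?invr_ge0 ?mnorm_ge0 // ?(ltW (pd_gt0 _)) ?rate_ge0.
Qed.

Lemma power_error_ratioE n :
  2 * (err n / size_T n) = (1 + n%:R ^+ d) * rate n * power_error_ratio n.
Proof.
(* If [b = 0] the rate is 0 and no division is possible, but the Taylor error vanishes too. *)
have [bz|bn0] := eqVneq b 0.
  suff -> : err n = 0.
    rewrite /power_error_ratio mul0r mulr0 /rate bz mulr0 mul0r.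
    by rewrite exprS mul0r mulr0 mul0r.
  apply/eqP; rewrite eq_le mnorm_ge0 andbT; apply: le_trans (err_le _) _.
  by rewrite /taylor_error -/b bz exprS !mul0r mulr0 mul0r mulr0.
rewrite /power_error_ratio [RHS]mulrC mulfVK // mulf_neq0 ?gt_eqF ?pd_gt0 //.
have bp : 0 < b by rewrite lt_neqAle eq_sym bn0.
by rewrite exprn_gt0 // divr_gt0 ?mulr_gt0 ?expR_gt0 ?ltr0n.
Qed.

(** One factor [expR b ^+ n] is the amplification in the powers, the other comes from the lower
    bound on [size_T n]. Together with the Taylor remainder they fit into [rate n], whose factor
    [2 ^ (n + 1)] is left over. *)
Let taylor_error_rate n :
  n%:R * taylor_error B n * expR b ^+ n * expR b ^+ n <=
  expR b * (n%:R / 2 ^+ n.+1 * rate n).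
Proof.
have -> : n%:R / 2 ^+ n.+1 * rate n =
    n%:R * ((expR 1 * b / n.+1%:R) ^+ n.+1 * (expR (2 * b)) ^+ n.+1).
  rewrite /rate -exprMn.
  have -> : expR 1 * (2 * expR (2 * b)) * b / n.+1%:R =
     2 * (expR 1 * b / n.+1%:R * expR (2 * b)) by ring.
  by rewrite [in LHS]exprMn [LHS]mulrA mulfVK // expf_neq0.
have -> : n%:R * taylor_error B n * expR b ^+ n * expR b ^+ n =
    expR b * (n%:R * (b ^+ n.+1 / n.+1`!%:R * expR (2 * b) ^+ n)).
  by rewrite /taylor_error -/b (mulr_natl b 2) mulr2n expRD exprMn; ring.
rewrite ler_wpM2l ?expR_ge0 // ler_wpM2l //.
apply: ler_pM; rewrite ?exprn_ge0 ?expR_ge0 ?divr_ge0 ?exprn_ge0 //.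
  exact: expr_div_fact_bound.
by rewrite exprS ler_peMl ?exprn_ge0 ?expR_ge0 // -[leLHS]expR0 ler_expR mulr_ge0.
Qed.

Let rate_le1 : \forall n \near \oo, rate n <= 1.
Proof.
near=> n; rewrite exprn_ile1 //.
  by rewrite divr_ge0 // !mulr_ge0 ?expR_ge0.
rewrite ler_pdivrMr ?ltr0n // mul1r.
apply: (@le_trans _ _ n%:R); last by rewrite ler_nat.
by near: n; exact: nbhs_infty_ger.
Unshelve. all: by end_near. Qed.

Lemma power_error_ratio_cvg0 : power_error_ratio n @[n --> \oo] --> (0 : R).
Proof.
(* One 2 comes from the definition of the ratio, the other from the lower bound on [size_T n]; one
   [expR b] comes from [Pbar], the other from the Taylor remainder. *)
pose K := 4 * expR b ^+ 2.
have g0 := @natr_div_expr2_cvg0 R.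
apply: (@squeeze_cvgr _ _ _ _ (fun=> 0) (fun n => K * (n%:R / 2 ^+ n.+1))); last 2 first.
- exact: cvg_cst.
- by rewrite -[X in _ --> X](mulr0 K); apply: cvgMr.
(* This threshold forces the error [t] below half of the lower bound [expR b ^- n] for the exact
   power. *)
have small : \forall n \near \oo, n%:R / 2 ^+ n.+1 <= (2 * expR b)^-1 :> R.
  have e0 : 0 < (2 * expR b)^-1 :> R by rewrite invr_gt0 mulr_gt0 ?expR_gt0.
  by apply: (cvgr_le _ g0).
near=> n; rewrite power_error_ratio_ge0 /=.
have gn : 0 <= n%:R / 2 ^+ n.+1 :> R by rewrite divr_ge0 // exprn_ge0.
have gs : n%:R / 2 ^+ n.+1 <= (2 * expR b)^-1 by near: n; exact: small.
set g := n%:R / 2 ^+ n.+1 in gn gs *.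
have [rz|rn0] := eqVneq (rate n) 0.
  rewrite /power_error_ratio rz mulr0 invr0 mulr0.
  by rewrite mulr_ge0 // mulr_ge0 // exprn_ge0 // expR_ge0.
have r1 : rate n <= 1 by near: n; exact: rate_le1.
have eb0 : 0 < expR b by exact: expR_gt0.
pose t := n%:R * taylor_error B n * expR b ^+ n.
have tr : t * expR b ^+ n <= expR b * (g * rate n) by exact: taylor_error_rate.
have t2 : t * expR b ^+ n <= 2^-1.
  apply: le_trans tr _.
  apply: le_trans (_ : expR b * g <= _).
    by rewrite ler_wpM2l ?(ltW eb0) // ler_piMr.
  by move: gs; rewrite invfM mulrC ler_pdivlMl // [_ * g]mulrC mulrC.
have ebn : 0 < expR b ^+ n by rewrite exprn_gt0.
(* The exact power of [V] has norm at least [expR b ^- n], and the perturbation [t] removes at most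
   half of that. *)
have sT : (2 * expR b ^+ n)^-1 <= size_T n.
  have h1 := mnorm_expmxX_ge B n V; rewrite V1 mulr1 expRN exprVn -/b in h1.
  have h2 := mnorm_exprB_partial B n n V; rewrite V1 mulr1 -/b -/t in h2.
  have h3 : mnorm (expmx B ^+ n *m V) - size_T n <= t.
    apply: le_trans (ler_mnormB _ _) (le_trans _ h2).
    by rewrite -mnormN opprB mulmxBl.
  have h4 : t <= 2^-1 * (expR b ^+ n)^-1 by rewrite ler_pdivlMr.
  rewrite invfM; move: h1 h3 h4; set x := (expR b ^+ n)^-1; lra.
have sT0 : 0 < size_T n by apply: lt_le_trans sT; rewrite invr_gt0 mulr_gt0.
have rn : 0 < rate n by rewrite lt_neqAle eq_sym rn0 rate_ge0.
rewrite /power_error_ratio ler_pdivrMr ?mulr_gt0 ?pd_gt0 //.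
have iT : (size_T n)^-1 <= 2 * expR b ^+ n.
  by rewrite -[leRHS]invrK lef_pV2 ?posrE ?invr_gt0 ?mulr_gt0.
have t0 : 0 <= t 
  by rewrite mulr_ge0 ?(ltW ebn) // mulr_ge0 // taylor_error_ge0.
have e1 : err n / size_T n <= expR b * (1 + n%:R ^+ d) * t * (2 * expR b ^+ n).
  by apply: ler_pM (err_le n) iT; rewrite ?invr_ge0 mnorm_ge0.
apply: le_trans (_ : 2 * (expR b * (1 + n%:R ^+ d) * t * (2 * expR b ^+ n)) <= _).
  by rewrite ler_wpM2l.
have -> : 2 * (expR b * (1 + n%:R ^+ d) * t * (2 * expR b ^+ n)) =
  4 * (expR b * (1 + n%:R ^+ d)) * (t * expR b ^+ n) by ring.
have -> : K * g * ((1 + n%:R ^+ d) * rate n) =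
  4 * (expR b * (1 + n%:R ^+ d)) * (expR b * (g * rate n)) by rewrite /K; ring.
by rewrite ler_wpM2l // !mulr_ge0 ?(ltW eb0) ?(ltW (pd_gt0 _)).
Unshelve. all: by end_near. Qed.

End normalized_power_error.

(** * Assembly of the error estimate *)

Unset Implicit Arguments.

Theorem theorem8p4 (R : realType) (m : nat) (A : 'M[R]_m) (delta Ds : R)
    (nu d : nat) (V : 'M[R]_m) :
  let s := spectral_bound A in
  let Y := \matrix_(i < m, j < m) Pi1 A (col j V) i 0 in
  let sbar := s + Ds in
  let Abar := A - sbar%:M in
  let lambdabar := 2 * expR (2 * mnorm Abar) in
  let Sn := fun n : nat => Siter Abar V n n in
  let P := fun n : nat => Pbar Abar d n%:R in
  let Yb := fun n : nat => Ybar Abar Y d n%:R in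
  (0 < m)%N ->
  Perron_like A ->
  0 < delta ->
  (forall mu : R[i], spectrum A mu -> mu <> real_complex R s ->
     complex.Re mu <= s - 2 * delta) ->
  is_Cord A s nu ->
  (nu - 1 <= d <= m - 1)%N ->
  V \in unitmx ->
  mnorm V = 1 ->
  `|Ds| < delta / 9 ->
  exists2 C : R, 0 < C &
  exists2 eps : nat -> R, eps n @[n --> \oo] --> (0 : R) &
  forall n : nat,
    Siter_defined Abar V n ->
    P n *m Sn n <> 0 ->
    Yb n <> 0 ->
    mnorm (normalized (P n *m Sn n) - normalized (Yb n)) <=
      C * (mnorm (P n *m Sn n))^-1 * (1 + n%:R ^+ d) *
        (expR 1 * lambdabar * mnorm Abar / (n.+1)%:R) ^+ n.+1 * eps n
      + C * (mnorm (Yb n))^-1 * (1 + n%:R ^+ (d + 2 * (nu - 1))) *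
        expR (- (2 / 9 * n%:R * delta)).
Proof.
(* Size 0 is excluded by [0 < m]; in size [m'.+1] matrices form a ring. *)
case: m A V => [//|m'] A V s Y sbar Abar lambdabar Sn P Yb _ _ delta0 spec _ _ _ V1 Ds9.
have [K K0 hK] : exists2 K, 0 <= K & forall n,
    mnorm (expmx (n%:R *: Abar) *m (V - Y)) <= K * expR (- (2 / 9 * delta * n%:R)).
  (* Since [|Ds| < delta / 9], the real parts of [mu - sbar] are at most [- (17 / 9) delta]; the
     margin down to the rate [2 / 9] absorbs the polynomial factors. *)
  apply: (@sub_Pi1_decay _ _ _ _ _ (2 * delta - delta / 9)); last by lra.
  move=> mu muA mus; have := spec mu muA mus.
  by move: Ds9; rewrite ltr_norml /sbar -/s => /andP[]; lra.
set b := mnorm Abar.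
(* The 1 serves the numerical term. In the spectral term, [expR b] comes from [Pbar], one 2 from
   [normalizedB] and the other from [1 + n ^ d <= 2 (1 + n ^ (d + 2 (nu - 1)))]. *)
exists (1 + 4 * expR b * K).
  by rewrite ltr_pwDl ?ltr01 // !mulr_ge0 ?expR_ge0.
exists (power_error_ratio Abar V d); first exact: power_error_ratio_cvg0.
move=> n Sdef PSn0 Yb0.
set C := 1 + _.
have C1 : 1 <= C by rewrite lerDl !mulr_ge0 ?expR_ge0.
have [SE T0] := Siter_power V1 Sdef.
set T := exp_partial Abar n in SE T0; set M := expmx Abar.
pose X := P n *m (T ^+ n *m V); pose Z := P n *m (M ^+ n *m V).
have Ti : 0 < (mnorm (T ^+ n *m V))^-1 by rewrite invr_gt0.
have PSE : P n *m Sn n = (mnorm (T ^+ n *m V))^-1 *: X.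
  by rewrite /Sn SE /normalized -scalemxAr.
have X0 : X <> 0 by move=> X0; apply: PSn0; rewrite PSE X0 scaler0.
have YbE : Yb n = P n *m (M ^+ n *m Y).
  by rewrite /Yb /Ybar expmx_natZ mulmxA.
(* Both differences are arranged so that [normalizedB] divides by the norm of [X] or of [Yb n],
   which are nonzero; [Z] may vanish. *)
have -> : normalized (P n *m Sn n) - normalized (Yb n) =
    (normalized X - normalized Z) - (normalized (Yb n) - normalized Z).
  by rewrite PSE normalizedZ // opprB addrA subrK.
apply: le_trans (mnormD _ _) _; rewrite mnormN; apply: lerD.
  apply: le_trans (normalizedB _ X0) _.
  have -> : X - Z = P n *m ((T ^+ n - M ^+ n) *m V) by rewrite mulmxBl mulmxBr.
  (* The norm of [X] is that of [P n *m Sn n] times that of [T ^+ n *m V], which brings out the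
     numerator of [power_error_ratio]. *)
  have -> : 2 * (mnorm X)^-1 * mnorm (P n *m ((T ^+ n - M ^+ n) *m V)) =
      (mnorm (P n *m Sn n))^-1 *
      (2 * (mnorm (P n *m ((T ^+ n - M ^+ n) *m V)) / mnorm (T ^+ n *m V))).
    rewrite PSE mnormZ (gtr0_norm Ti); field.
    by rewrite !gt_eqF // mnorm_gt0.
  rewrite (power_error_ratioE Abar d V1 n).
  rewrite -!mulrA ler_peMl //.
  apply: mulr_ge0; first by rewrite invr_ge0 mnorm_ge0.
  apply: mulr_ge0; first by rewrite addr_ge0 ?exprn_ge0.
  apply: mulr_ge0; last exact: power_error_ratio_ge0.
  by rewrite exprn_ge0 // !mulr_ge0 ?invr_ge0 ?expR_ge0 ?mnorm_ge0.
apply: le_trans (normalizedB _ Yb0) _.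
rewrite YbE -mulmxBr -mulmxBr -[Y - V]opprB !mulmxN mnormN -YbE.
have bound : mnorm (P n *m (M ^+ n *m (V - Y))) <=
    expR b * (2 * (1 + n%:R ^+ (d + 2 * (nu - 1)))) *
    (K * expR (- (2 / 9 * n%:R * delta))).
  apply: le_trans (mnorm_Pbar _ _ _ _) _.
  have := hK n; rewrite expmx_natZ -/M [2 / 9 * n%:R * delta]mulrAC => h.
  apply: ler_pM => //; rewrite ?mulr_ge0 ?expR_ge0 ?addr_ge0 ?exprn_ge0 ?mnorm_ge0 //.
  rewrite ler_wpM2l ?expR_ge0 //.
  (* The case [n = 0] is separate because of [0 ^ 0 = 1]; for positive [n] the powers increase with
     the exponent. *)
  set k := (2 * (nu - 1))%N; case: (n) => [|p].
    by rewrite !expr0n; case: (d) => [|q] /=; case: k => [|k] /=; lra.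
  have : p.+1%:R ^+ d <= p.+1%:R ^+ (d + k) :> R by rewrite ler_weXn2l ?ler1n ?leq_addr.
  have : 1 <= p.+1%:R ^+ (d + k) :> R by rewrite exprn_ege1 // ler1n.
  lra.
have Ybi : 0 <= 2 * (mnorm (Yb n))^-1 by rewrite mulr_ge0 // invr_ge0 mnorm_ge0.
apply: le_trans (ler_wpM2l Ybi bound) _.
set w := mnorm (Yb n); set p := 1 + _ ^+ (d + _); set e := expR (- _).
have -> : 2 * w^-1 * (expR b * (2 * p) * (K * e)) = (4 * expR b * K) * (w^-1 * p * e).
  by ring.
have -> : C * w^-1 * p * e = C * (w^-1 * p * e) by ring.
rewrite ler_wpM2r ?lerDr //.
by rewrite !mulr_ge0 ?invr_ge0 ?mnorm_ge0 ?expR_ge0 // addr_ge0 ?exprn_ge0.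
Qed.
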